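(* For every integer $n \geqslant 1$ and every integer $m$ with $0 \leqslant m \leqslant \binom{n}{2}$, there exists a divisor graph of order $n$ and size $m$.
   Context: For a set $V \subset \mathbb{Z}$, the divisor graph $G(V)$ is the (simple, undirected) graph with vertex set $V$ in which, for all $u \neq v \in V$, $uv$ is an edge if and only if $u \mid v$ or $v \mid u$. Any graph isomorphic to such a graph $G(V)$ is also called a divisor graph. The order of a graph is its number of vertices, and its size is its number of edges. *)

(* Defs.v *)
From mathcomp Require Import all_boot all_order all_algebra.
From mathcomp Require Import finmap.

Set Implicit Arguments.
Unset Strict Implicit.
Unset Printing Implicit Defensive.

Local Open Scope fset_scope.

Record sgraph : Type := SGraph {
  vertex :> finType;
  adj : rel vertex;
  adj_sym : symmetric adj;
  adj_irrefl : irreflexive adj }.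

Definition edges (G : sgraph) : {set {set G}} :=
  [set [set p.1; p.2] | p : G * G & adj p.1 p.2]%SET.

Definition graph_order (G : sgraph) : nat := #|G|.

Definition graph_size (G : sgraph) : nat := #|edges G|.

Definition isomorphic (G H : sgraph) : Prop :=
  exists2 f : G -> H, bijective f & {mono f : x y / adj x y}.

Section DivisorGraphOf.

Variable V : {fset int}.

Definition div_adj : rel V :=
  fun u v => (u != v) && ((val u %| val v)%Z || (val v %| val u)%Z).

Lemma div_adj_sym : symmetric div_adj.
Proof. by move=> u v; rewrite /div_adj eq_sym orbC. Qed.

Lemma div_adj_irrefl : irreflexive div_adj.
Proof. by move=> u; rewrite /div_adj eqxx. Qed.

Definition divisor_graph_of : sgraph := SGraph div_adj_sym div_adj_irrefl.

End DivisorGraphOf.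

(* V may be taken finite because G is: a vertex set in bijection with that of
   G is finite. V may contain 0 and negative integers. *)
Definition is_divisor_graph (G : sgraph) : Prop :=
  exists V : {fset int}, isomorphic G (divisor_graph_of V).

(* Main.v *)
(* Start from the empty set and add integers one at a time.  With P the product
   of the integers present, 2 * P is adjacent to all of them and 1 + P to none,
   provided they all exceed 1.  The (i+1)-st vertex thus brings i edges or none,
   and every m <= 'C(n, 2) is a sum of distinct elements of {1, ..., n - 1}. *)
Require Import Defs.
From mathcomp Require Import all_boot all_order all_algebra.
From mathcomp Require Import finmap.
From mathcomp Require Import zify.

Set Implicit Arguments.
Unset Strict Implicit.
Unset Printing Implicit Defensive.

Import Order.TTheory GRing.Theory Num.Theory.

(** An edge is an unordered pair; asymmetry of [r] lets exactly one of its two orderings satisfy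
    [r], so edges can be counted as ordered pairs. *)
Lemma graph_size_oriented (G : sgraph) (r : rel G) :
  (forall x y, adj x y = r x y || r y x) ->
  (forall x y, r x y -> ~~ r y x) ->
  graph_size G = \sum_(x : G) \sum_(y : G) r x y.
Proof.
move=> adjE r_asym.
have edgesE : edges G = [set [set p.1; p.2] | p : G * G & r p.1 p.2].
  apply/setP=> e; apply/imsetP/imsetP=> [] [[x y]].
    rewrite inE /= adjE => /orP[rxy ->|ryx ->].
      by exists (x, y); rewrite ?inE.
    by exists (y, x); rewrite ?inE // setUC.
  by rewrite inE /= => rxy ->; exists (x, y); rewrite ?inE //= adjE rxy.
rewrite /graph_size edgesE card_in_imset.
  by rewrite -sum1dep_card pair_big big_mkcond.
move=> [a b] [c d]; rewrite !inE /= => rab rcd eq_e.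
have neq x y : r x y -> x != y.
  move=> rxy; apply: contraL (r_asym _ _ rxy) => /eqP eqxy.
  by rewrite negbK -eqxy {2}eqxy.
(* Of the four ways to match [a] and [b] with [c] and [d], the two that give [a = b] contradict
   irreflexivity, and the swap contradicts asymmetry. *)
have /set2P[ac|ad] : a \in [set c; d] by rewrite -eq_e set21.
  have /set2P[bc|->] : b \in [set c; d] by rewrite -eq_e set22.
    by move: (neq _ _ rab); rewrite ac bc eqxx.
  by rewrite ac.
have /set2P[bc|bd] : b \in [set c; d] by rewrite -eq_e set22.
  by move: (r_asym _ _ rab); rewrite ad bc rcd.
by move: (neq _ _ rab); rewrite ad bd eqxx.
Qed.

Local Open Scope fset_scope.
Local Open Scope ring_scope.

Lemma dvdz_le (d m : int) : 0 < m -> (d %| m)%Z -> d <= m.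
Proof.
move=> m_gt0 /dvdn_leq le_dm; have := le_dm; lia.
Qed.

(** Orients an edge from divisor to multiple. This is asymmetric on positive integers, but not on
    all of them: [u] and [- u] divide each other. *)
Definition sdvdz (u v : int) : bool := (u != v) && (u %| v)%Z.

Lemma graph_size_divisor (V : {fset int}) :
  (forall u, u \in V -> 0 < u) ->
  graph_size (divisor_graph_of V) =
    (\sum_(u <- V) \sum_(v <- V) sdvdz u v)%N.
Proof.
move=> V_gt0; rewrite (@graph_size_oriented (divisor_graph_of V)
  (fun u v : V => sdvdz (val u) (val v))).
- rewrite big_seq_fsetE /=; apply: eq_bigr => u _.
  by rewrite [RHS]big_seq_fsetE.
- move=> u v /=; rewrite /div_adj /sdvdz -(inj_eq val_inj).
  by rewrite (eq_sym (val v)) -andb_orr.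
move=> u v /andP[neq_uv dvd_uv]; apply/negP => /andP[_ dvd_vu].
case/eqP: neq_uv; apply: le_anti.
by rewrite !dvdz_le // V_gt0 //; apply: valP.
Qed.

(** In the orientation by [sdvdz] the new vertex [x] is a sink, so the new edges are exactly the [k]
    pairs with [u] in [V] dividing [x]. *)
Lemma graph_size_fsetU1 (V : {fset int}) (x : int) (k : nat) :
  0 < x -> (forall u, u \in V -> 0 < u) ->
  (forall u, u \in V -> ~~ (x %| u)%Z) ->
  (\sum_(u <- V) (u %| x)%Z = k)%N ->
  graph_size (divisor_graph_of (x |` V)) =
    (k + graph_size (divisor_graph_of V))%N.
Proof.
move=> x_gt0 V_gt0 x_ndvd <-.
have xV : x \notin V by apply/negP => /x_ndvd; rewrite dvdzz.
have xV_gt0 u : u \in x |` V -> 0 < u by case/fset1UP => [->|/V_gt0].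
rewrite !graph_size_divisor // big_fsetU1 //= big_fsetU1 //= {1}/sdvdz eqxx /=.
(* The row of [x] vanishes; the column of [x] remains, next to the double sum over [V]. *)
rewrite big_seq big1 => [|u uV]; last by rewrite /sdvdz (negbTE (x_ndvd _ uV)) andbF.
rewrite add0n -big_split /= !add0n big_seq [RHS]big_seq.
apply: eq_bigr => u uV; rewrite big_fsetU1 //= /sdvdz.
by case: eqP => // eq_ux; rewrite -eq_ux uV in xV.
Qed.

(** The bound [1 < u] is carried through the induction to keep [1 + P] free of divisors in [V]. *)
Lemma exists_divisor_set (n m : nat) : (m <= 'C(n, 2))%N ->
  exists V : {fset int}, [/\ forall u, u \in V -> 1 < u, #|` V| = n
    & graph_size (divisor_graph_of V) = m].
Proof.
elim: n m => [|n IHn] m.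
  rewrite leqn0 => /eqP ->; exists fset0; split=> //.
  by rewrite graph_size_divisor ?big_seq_fset0.
rewrite binS bin1 => le_m.
(* [b] tells whether the new vertex is joined to all [n] old ones or to none; the old ones must
   supply the other [m - b * n] edges. *)
suff [b [le_bm le_mb]] : exists b : bool,
    (b * n <= m)%N /\ (m - b * n <= 'C(n, 2))%N.
  have [V [V_gt1 cardV sizeV]] := IHn _ le_mb.
  have V_gt0 u : u \in V -> 0 < u by move=> /V_gt1; lia.
  pose P := \prod_(v <- V) v.
  have P_gt0 : 0 < P by rewrite /P big_seq; apply: prodr_gt0.
  have dvdP u : u \in V -> (u %| P)%Z.
    by move=> uV; rewrite /P (big_fsetD1 u) //= dvdz_mulr.
  pose x := if b then 2 * P else 1 + P.
  have x_gtP : P < x by rewrite /x; case: b {le_bm le_mb sizeV x}; lia.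
  have x_gt1 : 1 < x by lia.
  (* Each [u] in [V] divides [P], so [u <= P < x]. *)
  have x_ndvd u : u \in V -> ~~ (x %| u)%Z.
    move=> uV; apply/negP => /(dvdz_le (V_gt0 _ uV)).
    by have := dvdz_le P_gt0 (dvdP _ uV); lia.
  have dvdx u : u \in V -> (u %| x)%Z = b.
    move=> uV; rewrite /x; case: b {le_bm le_mb sizeV x x_gtP x_gt1 x_ndvd}.
      by rewrite dvdz_mull ?dvdP.
    (* As [u] divides [P], dividing [1 + P] would make it divide 1. *)
    rewrite rpredDr ?dvdP //; apply/negP => /(dvdz_le ltr01).
    by have := V_gt1 _ uV; lia.
  exists (x |` V); split.
  - by move=> u /fset1UP[->|/V_gt1].
  - rewrite cardfsU1 cardV.
    by case: (boolP (x \in V)) => // /x_ndvd; rewrite dvdzz.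
  rewrite (@graph_size_fsetU1 _ _ (b * n)%N) ?sizeV ?subnKC //; first by lia.
  rewrite big_seq (eq_bigr (fun=> b : nat)) => [|u /dvdx -> //].
  by rewrite -big_seq big_const_seq count_predT iter_addn_0 cardV.
(* Greedy choice: take the [n] edges whenever [n <= m]. Otherwise [m <= n - 1], which is at most
   ['C(n, 2)]. *)
have [le_nm|lt_mn] := leqP n m; first by exists true; rewrite mul1n; lia.
exists false; rewrite mul0n subn0; split=> //.
case: n lt_mn {IHn le_m} => [|[|n]] //.
by rewrite binS bin1; lia.
Qed.

Theorem theorem1 :
  forall n m : nat, (1 <= n)%N -> (m <= 'C(n, 2))%N ->
  exists G : sgraph,
    [/\ is_divisor_graph G, graph_order G = n & graph_size G = m].
Proof.
move=> n m _ /exists_divisor_set[V [_ cardV sizeV]].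
exists (divisor_graph_of V); split=> //; last by rewrite /graph_order -cardfE.
by exists V, id => //; exists id.
Qed.
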